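(* There exists a family $\mathcal F\subseteq\mathcal{AN}$ of size $\mathfrak d$ consisting of density ideals such that for every $\mathcal I\in\mathcal{AN}$ there is $\mathcal J\in\mathcal F$ with $\mathcal I\le_K\mathcal J$.
   Context: For a free filter $F$ on $\omega$, $N_F=\omega\cup\{p_F\}$ has points of $\omega$ isolated and neighbourhoods of $p_F$ of form $A\cup\{p_F\}$, $A\in F$. $F$ has the Nikodym property if there is no sequence of finitely supported measures $\mu_n=\sum_i\alpha_i\delta_{x_i}$ on $N_F$ with $\|\mu_n\|=\sum|\alpha_i|\to\infty$ and $\mu_n(A)\to0$ for all clopen $A\subseteq N_F$. $\mathcal{AN}$ is the class of ideals $\mathcal I$ on $\omega$ (duals of free filters) whose dual filter $\mathcal I^*=\{\omega\setminus X:X\in\mathcal I\}$ lacks the Nikodym property. A density ideal is one of the form $\{X:\lim_n\mu_n(X)=0\}$ for finitely supported non-negative measures $\mu_n$ on $\omega$ with pairwise disjoint supports. $\mathcal I\le_K\mathcal J$ if some $f\colon\omega\to\omega$ has $f^{-1}[A]\in\mathcal J$ for all $A\in\mathcal I$. $\mathfrak d$ is the dominating number: least size of a family in $\omega^\omega$ dominating every function modulo finite. *)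

(* Defs.v *)
From HB Require Import structures.
From mathcomp Require Import all_boot all_order all_algebra.
From mathcomp Require Import all_classical all_reals all_analysis.
Set Implicit Arguments.
Unset Strict Implicit.
Unset Printing Implicit Defensive.
Import Order.TTheory GRing.Theory Num.Theory.
Import numFieldNormedType.Exports.
Local Open Scope classical_set_scope.
Local Open Scope ring_scope.
Local Open Scope card_scope.

Definition free_filter (F : set_system nat) : Prop :=
  \bigcap_(A in F) A = set0.

(* The space N_F; [Some n] is the point n of omega and [None] is p_F. *)
Definition NF (F : filter_on nat) : Type := option nat.

HB.instance Definition _ (F : filter_on nat) := Choice.copy (NF F) (option nat).

Definition nbhs_NF (F : filter_on nat) (x : NF F) : set_system (NF F) :=
  if x is Some n then principal_filter (Some n)
  else [set (Some @` A) `|` [set None] | A in filter F].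

Lemma nbhs_NF_NoneP (F : filter_on nat) (U : set (NF F)) :
  @nbhs_NF F None U <-> U None /\ filter F (Some @^-1` U).
Proof.
split=> [[A FA <-]|[UN FU]].
  split; first by right.
  by apply: filterS FA => n An; left; exists n.
exists (Some @^-1` U) => //; apply/seteqP; split=> [x|[n|] Ux].
- by move=> [[n Un <-]|->].
- by left; exists n.
- by right.
Qed.

HB.instance Definition _ (F : filter_on nat) :=
  hasNbhs.Build (NF F) (@nbhs_NF F).

Lemma nbhs_NF_filter (F : filter_on nat) (x : NF F) : ProperFilter (nbhs x).
Proof.
case: x => [n|]; first exact: (principal_filter_proper (Some n)).
split; first by move=> /nbhs_NF_NoneP[].
split.
- by apply/nbhs_NF_NoneP; split=> //; exact: filterT.
- move=> U V /nbhs_NF_NoneP[UN FU] /nbhs_NF_NoneP[VN FV].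
  by apply/nbhs_NF_NoneP; split=> //; exact: filterI FU FV.
- move=> U V UV /nbhs_NF_NoneP[UN FU]; apply/nbhs_NF_NoneP; split.
    exact: UV.
  by apply: filterS FU => n; exact: UV.
Qed.

Lemma nbhs_NF_singleton (F : filter_on nat) (x : NF F) (U : set (NF F)) :
  nbhs x U -> U x.
Proof. by case: x => [n /principal_filterP|/nbhs_NF_NoneP[]]. Qed.

Lemma nbhs_NF_nbhs (F : filter_on nat) (x : NF F) (U : set (NF F)) :
  nbhs x U -> nbhs x (nbhs^~ U).
Proof.
case: x => [n|] xU; first exact/principal_filterP.
apply/nbhs_NF_NoneP; split=> //.
move/nbhs_NF_NoneP: xU => [_ FU]; apply: filterS FU => n Un.
exact/principal_filterP.
Qed.

HB.instance Definition _ (F : filter_on nat) :=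
  Nbhs_isNbhsTopological.Build (NF F)
    (@nbhs_NF_filter F) (@nbhs_NF_singleton F) (@nbhs_NF_nbhs F).

(* A finitely supported signed measure \sum_x (m x) * delta_x on T is given by
   its weight function m; its value at A is then \sum_(x \in A) m x. *)
Definition supp (R : realType) (T : choiceType) (m : T -> R) : set T :=
  [set x | m x != 0].

Definition fin_meas (R : realType) (T : choiceType) (m : T -> R) : Prop :=
  finite_set (supp m).

Definition meas (R : realType) (T : choiceType) (m : T -> R) (A : set T) : R :=
  \sum_(x \in A) m x.

Definition tvnorm (R : realType) (T : choiceType) (m : T -> R) : R :=
  \sum_(x \in [set: T]) `|m x|.

Definition nikodym (R : realType) (F : filter_on nat) : Prop :=
  ~ exists mu : nat -> NF F -> R,
      [/\ forall n, fin_meas (mu n),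
          tvnorm (mu n) @[n --> \oo] --> +oo &
          forall A : set (NF F), clopen A ->
            meas (mu n) A @[n --> \oo] --> (0 : R)].

Definition dual_filter (I : set (set nat)) : set_system nat :=
  [set ~` X | X in I].

Definition AN (R : realType) : set (set (set nat)) :=
  [set I | exists F : pfilter_on nat,
    [/\ free_filter F, dual_filter I = F & ~ nikodym R F]].

Definition density_ideal (R : realType) (I : set (set nat)) : Prop :=
  exists mu : nat -> nat -> R,
    [/\ forall n, fin_meas (mu n),
        forall n i, 0 <= mu n i,
        trivIset [set: nat] (fun n => supp (mu n)) &
        I = [set X | meas (mu n) X @[n --> \oo] --> (0 : R)]].

Definition katetov_le (I J : set (set nat)) : Prop :=
  exists f : nat -> nat, forall A, I A -> J (f @^-1` A).

Definition dominating (D : set (nat -> nat)) : Prop :=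
  forall g : nat -> nat,
    exists2 f, D f & \forall n \near \oo, (g n <= f n)%N.

(* S has cardinality d, the least cardinality of a dominating family. *)
Definition has_card_d (T : Type) (S : set T) : Prop :=
  (exists2 D, dominating D & S #= D) /\
  (forall D, dominating D -> S #<= D).

(* Main.v *)
Require Import Defs.
From mathcomp Require Import all_boot all_order all_algebra.
From mathcomp Require Import all_classical all_reals all_analysis.
Set Implicit Arguments.
Unset Strict Implicit.
Unset Printing Implicit Defensive.
Import Order.TTheory GRing.Theory Num.Theory.
Import numFieldNormedType.Exports.
Local Open Scope classical_set_scope.
Local Open Scope ring_scope.
Local Open Scope card_scope.

(** An ideal is in AN exactly when it is contained in a density ideal given by
    finitely supported measures nu_k with pairwise disjoint supports and masses
    tending to infinity. Rounding nu_k down to multiples of a small weight, one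
    sees that it dominates an image of the measure with total mass k spread
    evenly over h(k) + 1 atoms, as soon as h(k) is larger than the support of
    nu_k. Hence the ideals of these uniform measures, for h in a dominating
    family, are Katetov-cofinal in AN. The ideal determines h modulo finite, so
    a dominating family of least cardinality yields exactly d ideals. *)

(** * Families of least cardinality and the cardinal d *)

(* Honig's argument: a maximal set of choice functions that are pairwise
   different at every coordinate projects injectively to each coordinate, and
   by maximality onto some coordinate. *)
Lemma exists_min_card (T : Type) (DD : set (set T)) :
  DD !=set0 -> exists2 D, DD D & forall E, DD E -> D #<= E.
Proof.
move=> DD0.
pose P (S : set (set T -> T)) := (forall phi D, S phi -> DD D -> D (phi D)) /\
  forall phi psi D, S phi -> S psi -> DD D -> phi D = psi D -> phi = psi.
have [|S [[SD Sinj] Smax]] := @Zorn_bigcup _ P.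
  move=> F FP Ftot; split=> [phi D [S FS Sphi] DDD|].
    by have [SD _] := FP _ FS; exact: SD Sphi DDD.
  move=> phi psi D [S FS Sphi] [S' FS' Spsi].
  have [SS'|S'S] := Ftot _ _ FS FS'.
    by have [_] := FP _ FS'; apply => //; exact: SS'.
  by have [_] := FP _ FS; apply => //; exact: S'S.
have [D DDD DS] : exists2 D, DD D & D `<=` (@^~ D) @` S.
  apply: contrapT => /forall2NP noD.
  have /choice[x xP] D : exists x, DD D -> D x /\ ~ ((@^~ D) @` S) x.
    have [//|/existsNP[x /not_implyP[Dx Sx]]] := noD D.
      have [E DDE] := DD0; have [//|/existsNP[x _]] := noD E.
      by exists x.
    by exists x.
  refine (Smax (S `|` [set x]) _ _).
    split; first exact: subsetUl.
    move=> /(_ x (or_intror erefl)) Sx.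
    by have [E DDE] := DD0; have [_ nS] := xP _ DDE; apply: nS; exists x.
  split=> [phi D [/SD|->]|phi psi D [Sphi|->] [Spsi|->]] //; first exact.
  - by move=> /xP[].
  - exact: Sinj.
  - by move=> /xP[_ nS] e; exfalso; apply: nS; exists phi.
  - by move=> /xP[_ nS] e; exfalso; apply: nS; exists psi.
exists D => // E DDE; apply: (@card_le_trans _ _ _ S).
  exact: card_le_trans (subset_card_le DS) (card_image_le _ _).
rewrite -(card_le_eql (@inj_card_eq _ _ S (@^~ E) _)).
  by apply: subset_card_le => _ [phi Sphi <-]; exact: SD Sphi DDE.
by move=> phi psi /set_mem Sphi /set_mem Spsi /= e; exact: Sinj Sphi Spsi DDE e.
Qed.

Definition eventually_eq (g h : nat -> nat) := \forall n \near \oo, g n = h n.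

(** Eventual equality preserves domination, so picking one representative in [D] for each member of
    the image leaves a dominating family in bijection with the image. *)
Lemma has_card_d_image (T : Type) (J : (nat -> nat) -> T) (D : set (nat -> nat)) :
  (forall g h, J g = J h -> eventually_eq g h) ->
  dominating D -> (forall E, dominating E -> D #<= E) -> has_card_d (J @` D).
Proof.
move=> Jinj domD minD; split; last first.
  by move=> E domE; exact: card_le_trans (card_image_le _ _) (minD _ domE).
have /choice[r rP] t : exists h, (J @` D) t -> D h /\ J h = t.
  by have [[h Dh Jh]|nJ] := pselect ((J @` D) t); [exists h|exists id].
exists (r @` (J @` D)).
  move=> g; have [h Dh gh] := domD g.
  have [_ e] := rP (J h) (imageP J Dh).
  exists (r (J h)); first by exists (J h) => //; exists h.
  by near do (rewrite (near (Jinj _ _ e) _ _) //; exact: (near gh)).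
rewrite card_eq_sym; apply: inj_card_eq => s t /set_mem Js /set_mem Jt rst.
by rewrite -(rP _ Js).2 -(rP _ Jt).2 rst.
Unshelve. all: by end_near. Qed.

(** * Finitely supported measures on a set and on N_F *)

Section finite_measures.
Context {R : realType}.

Section choice_type.
Context {T : choiceType}.
Implicit Types (m : T -> R) (A B : set T) (s : seq T).

Lemma fin_measP m : fin_meas m -> exists2 s, uniq s & supp m `<=` [set` s].
Proof.
move=> /finite_seqP[s ms]; exists (undup s); first exact: undup_uniq.
by rewrite ms => x /=; rewrite mem_undup.
Qed.

(** Bridge from set-indexed sums to list-indexed ones; [s] may be any duplicate-free list covering
    the support inside [A], so that several measures or sets can share one list. *)
Lemma meas_seq m A s : uniq s -> A `&` supp m `<=` [set` s] ->
  meas m A = \sum_(x <- s | x \in A) m x.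
Proof.
move=> us ms; rewrite /meas (@fsbigE _ _ _ _ _ [seq x <- s | x \in A]).
- by rewrite big_filter_cond; apply: eq_bigl => x; rewrite andbb.
- exact: filter_uniq.
- by move=> x /=; rewrite mem_filter => /andP[/set_mem].
- move=> x Ax; rewrite mem_filter mem_set //= => xs; apply/eqP/negPn/negP => mx.
  by move/negP: xs; apply; apply: ms.
Qed.

Lemma supp_norm m : supp (fun x => `|m x|) = supp m.
Proof. by apply/seteqP; split=> x; rewrite /supp /= normr_eq0. Qed.

Lemma measID m A B : fin_meas m ->
  meas m A = meas m (A `&` B) + meas m (A `\` B).
Proof.
move=> /fin_measP[s us ms].
rewrite !(@meas_seq m _ s us); try by move=> x [_ /ms].
rewrite (bigID (mem B)) /=; congr (_ + _); apply: eq_bigl => x.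
  by rewrite in_setI.
by rewrite in_setD.
Qed.

Lemma meas_ge0 m A : (forall x, 0 <= m x) -> 0 <= meas m A.
Proof. by move=> m0; apply: fsumr_ge0. Qed.

Lemma ler_meas m A B : fin_meas m -> (forall x, 0 <= m x) -> A `<=` B ->
  meas m A <= meas m B.
Proof.
move=> fm m0 AB; rewrite (measID B A fm) (setIidr AB) lerDl.
exact: meas_ge0.
Qed.

Lemma meas_setU m A B : fin_meas m -> (forall x, 0 <= m x) ->
  meas m (A `|` B) <= meas m A + meas m B.
Proof.
move=> fm m0; rewrite (measID _ A fm) setUK lerD2l.
by apply: ler_meas => // x [[|]].
Qed.

Lemma measN m A : fin_meas m -> meas (fun x => - m x) A = - meas m A.
Proof.
move=> /fin_measP[s us ms]; rewrite !(@meas_seq _ _ s us) ?sumrN //.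
  by move=> x [_ /ms].
by move=> x [_]; rewrite /supp /= oppr_eq0 => /ms.
Qed.

Lemma ler_norm_meas m A : fin_meas m -> `|meas m A| <= meas (fun x => `|m x|) A.
Proof.
move=> /fin_measP[s us ms]; rewrite !(@meas_seq _ _ s us) ?ler_norm_sum //.
  by rewrite supp_norm => x [_ /ms].
by move=> x [_ /ms].
Qed.

End choice_type.

Lemma meas_NF (F : filter_on nat) (mu : NF F -> R) (A : set (NF F)) :
  fin_meas (mu \o Some) ->
  meas mu A = meas (mu \o Some) (Some @^-1` A) + (if None \in A then mu None else 0).
Proof.
move=> /fin_measP[s us ms].
rewrite (@meas_seq _ _ _ s us); last by move=> x [_ /ms].
rewrite (@meas_seq _ _ _ (None :: map Some s)).
- rewrite big_cons big_map; under eq_bigl do rewrite -[Some _ \in A]/(_ \in Some @^-1` A).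
  by case: ifP => _; rewrite ?addr0 // addrC.
- rewrite cons_uniq map_inj_uniq ?us ?andbT => [|? ? []//].
  by apply/mapP => -[].
- move=> [x|] [_ mx] /=; rewrite inE //= mem_map; first exact: ms.
  by move=> ? ? [].
Qed.

Lemma fin_meas_NF (F : filter_on nat) (mu : NF F -> R) :
  fin_meas mu <-> fin_meas (mu \o Some).
Proof.
split=> [fm|/fin_measP[s us ms]].
  by apply: finite_preimage fm => ? ? _ _ [].
apply: (@sub_finite_set _ _ [set` None :: map Some s]); last exact: finite_seq.
by move=> [x|] //= /ms ?; rewrite inE /=; apply: map_f.
Qed.

Lemma finite_nat_bounded (A : set nat) : finite_set A -> exists N, A `<=` `I_N.
Proof.
move=> /finite_seqP[s ->]; exists (\max_(x <- s) x).+1 => x /= xs.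
by rewrite ltnS; apply: leq_bigmax_seq.
Qed.

End finite_measures.

(** * Membership in AN in terms of sequences of measures on omega *)

Section nikodym_ideals.
Context {R : realType}.

Lemma dual_filterE (I : set (set nat)) (A : set nat) : dual_filter I A <-> I (~` A).
Proof. by split=> [[X IX <-]|IA]; rewrite ?setCK //; exists (~` A); rewrite ?setCK. Qed.

(** The weight [- meas (nu n) setT] at p_F makes the total value zero while the norms still tend to
    infinity. Convergence at points makes the dual filter free, growth of the masses makes it
    proper. *)
Lemma AN_of_measures (nu : nat -> nat -> R) :
  (forall n, fin_meas (nu n)) -> (forall n x, 0 <= nu n x) ->
  (forall x, nu n x @[n --> \oo] --> 0) ->
  meas (nu n) setT @[n --> \oo] --> +oo ->
  AN R [set X | meas (nu n) X @[n --> \oo] --> (0 : R)].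
Proof.
move=> fnu nu0 nux nuT; set J := [set X | _].
have JP X : J X <-> meas (nu n) X @[n --> \oo] --> (0 : R) by [].
have Jsub X Y : X `<=` Y -> J Y -> J X.
  move=> XY /JP JY; apply/JP; apply: (squeeze_cvgr _ (cvg_cst 0) JY).
  by near=> n; rewrite meas_ge0 //= ler_meas.
have FJ : ProperFilter (dual_filter J).
  apply: Build_ProperFilter.
    move=> /dual_filterE; rewrite setC0 => /JP nuT0.
    have n1 : \forall n \near \oo, 1 < meas (nu n) setT by exact: cvgry_gt.
    have n0 : \forall n \near \oo, `|meas (nu n) setT| < 1 by exact: cvgr0_norm_lt.
    have [n [lt1 /(le_lt_trans (ler_norm _))]] := filter_ex (filterI n1 n0).
    by rewrite ltNge (ltW lt1).
  split.
  - apply/dual_filterE; rewrite setCT; apply/JP.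
    rewrite [X in X @ _](_ : _ = cst 0); first exact: cvg_cst.
    by apply/funext => n; rewrite /meas fsbig_set0.
  - move=> X Y /dual_filterE/JP JX /dual_filterE/JP JY.
    apply/dual_filterE/JP; rewrite setCI.
    have JXY : meas (nu n) (~` X) + meas (nu n) (~` Y) @[n --> \oo] --> (0 : R).
      by rewrite -[0]addr0; exact: cvgD.
    apply: (squeeze_cvgr _ (cvg_cst 0) JXY).
    by near=> n; rewrite meas_ge0 //= meas_setU.
  - move=> X Y XY /dual_filterE JX; apply/dual_filterE; apply: Jsub JX.
    exact: subsetC.
exists (PFilterPack _ FJ); split=> //.
  apply/seteqP; split=> // x /(_ (~` [set x])); apply => //.
  apply/dual_filterE/JP; rewrite setCK.
  by apply: cvg_trans (nux x); under eq_fun do rewrite /meas fsbig_set1; exact: cvg_refl.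
apply: contraPP; move=> _; apply.
pose mu n (o : NF (PFilterPack _ FJ)) : R :=
  if o is Some x then nu n x else - meas (nu n) setT.
have fmu n : fin_meas (mu n) by apply/fin_meas_NF; exact: fnu.
exists mu; split => //.
  apply: ger_cvgy nuT; near=> n.
  rewrite [leRHS](meas_NF (mu := fun x => `|mu n x|)); last first.
    by apply/fin_meas_NF; rewrite /fin_meas supp_norm; exact: fmu.
  rewrite preimage_setT in_setT (_ : (fun _ => _) \o Some = nu n).
    by rewrite lerDl.
  by apply/funext => x; rewrite /= ger0_norm.
move=> A [oA cA].
have -> : (fun n => meas (mu n) A) = fun n => meas (nu n) (Some @^-1` A) +
    (if None \in A then - meas (nu n) setT else 0).
  by apply/funext => n; rewrite (meas_NF (mu := mu n) A (fnu n)).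
(* If the clopen set contains p_F, the negative weight turns its value into minus that of the
   complementary trace on omega, which lies in [J]; otherwise its own trace lies in [J]. *)
have [/set_mem AN|/negP NAN] := boolP (None \in A).
  have : nbhs (None : NF (PFilterPack _ FJ)) A by exact: open_nbhs_nbhs.
  move=> /nbhs_NF_NoneP[_ /dual_filterE/JP/cvgN]; rewrite oppr0 => JA.
  rewrite (_ : (fun n => _) = - (fun n => meas (nu n) (~` (Some @^-1` A)))) //.
  apply/funext => n; rewrite (measID setT (Some @^-1` A) (fnu _)).
  by rewrite setTI setTD opprD addNKr.
have : nbhs (None : NF (PFilterPack _ FJ)) (~` A).
  by apply: open_nbhs_nbhs; split; [exact: closed_openC|by move=> /mem_set].
move=> /nbhs_NF_NoneP[_ /dual_filterE/JP]; rewrite preimage_setC setCK => JA.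
by rewrite -[0 in X in _ --> X]addr0; apply: cvgD => //; exact: cvg_cst.
Unshelve. all: by end_near. Qed.

Lemma clopen_NF_ideal (F : filter_on nat) (X : set nat) : filter F (~` X) ->
  clopen (Some @` X : set (NF F)).
Proof.
move=> FX; split; rewrite ?openE.
  by move=> _ [x Xx <-]; apply/principal_filterP; exists x.
rewrite -openC openE => -[x nXx|_]; first exact/principal_filterP.
apply/nbhs_NF_NoneP; split; first by case.
by apply: filterS FX => x nXx [y Xy [yx]]; apply: nXx; rewrite -yx.
Qed.

(** The weight at p_F is the total value minus the value on omega. As [setT] is clopen, the total
    tends to 0 along a witness against the Nikodym property, so forgetting p_F keeps the norms
    tending to infinity. *)
Lemma tvnorm_NF_le (F : filter_on nat) (mu : NF F -> R) : fin_meas mu ->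
  tvnorm mu <= tvnorm (mu \o Some) *+ 2 + `|meas mu setT|.
Proof.
move=> fm; have fm' := (fin_meas_NF mu).1 fm.
have -> : tvnorm mu = tvnorm (mu \o Some) + `|mu None|.
  rewrite [LHS](meas_NF (mu := fun x => `|mu x|)); last first.
    by apply/fin_meas_NF; rewrite /fin_meas supp_norm.
  by rewrite preimage_setT in_setT.
have : `|mu None| <= `|meas mu setT| + `|meas (mu \o Some) setT|.
  rewrite (meas_NF _ fm') preimage_setT in_setT.
  rewrite -[X in `|X| <= _](addKr (meas (mu \o Some) setT)) addrC.
  exact: ler_normB.
move/le_trans => /(_ (`|meas mu setT| + tvnorm (mu \o Some))).
rewrite lerD2l => /(_ (ler_norm_meas _ fm')) le.
by rewrite mulr2n -addrA lerD2l addrC.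
Qed.

Lemma AN_measures (I : set (set nat)) : AN R I ->
  [/\ forall X Y, X `<=` Y -> I Y -> I X, forall x, I [set x] &
  exists m : nat -> nat -> R,
  [/\ forall n, fin_meas (m n), tvnorm (m n) @[n --> \oo] --> +oo &
      forall X, I X -> meas (m n) X @[n --> \oo] --> 0]].
Proof.
move=> [F [freeF IF]] /contrapT[mu [fmu muy mu0]].
have IP X : I X <-> filter F (~` X).
  by rewrite -[filter F _]/((F : set_system nat) _) -IF dual_filterE setCK.
split.
- by move=> X Y XY /IP FY; apply/IP; apply: filterS FY; exact: subsetC.
- move=> x; apply/IP; have : ~ (\bigcap_(A in (F : set_system nat)) A) x.
    by rewrite freeF.
  move=> /existsNP[A /not_implyP[FA Ax]].
  by apply: filterS FA => y Ay yx; apply: Ax; rewrite -yx.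
have fm n : fin_meas (mu n \o Some) by apply/fin_meas_NF.
exists (fun n => mu n \o Some); split => //; last first.
  move=> X /IP FX; have := mu0 _ (clopen_NF_ideal FX).
  rewrite [X in X @ _](_ : _ = fun n => meas (mu n \o Some) X) //.
  apply/funext => n; rewrite (meas_NF _ (fm n)) memNset ?addr0; last by move=> [].
  by congr meas; apply/seteqP; split=> [x [y Xy [<-]]|x Xx] //; exists x.
apply/cvgryPge => A.
have muT : \forall n \near \oo, `|meas (mu n) setT| < 1.
  by apply: cvgr0_norm_lt => //; apply: mu0; exact: clopenT.
(* The threshold absorbs the factor 2 and the total value, below 1, in [tvnorm_NF_le]. *)
have muA : \forall n \near \oo, A *+ 2 + 1 <= tvnorm (mu n) by exact: cvgry_ge.
near=> n.
have An : A *+ 2 + 1 <= tvnorm (mu n) by near: n.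
have mn : `|meas (mu n) setT| < 1 by near: n.
have : A *+ 2 + 1 <= tvnorm (mu n \o Some) *+ 2 + 1.
  rewrite (le_trans An) // (le_trans (tvnorm_NF_le (fmu n))) //.
  by rewrite lerD2l ltW.
by rewrite lerD2r lerMn2r.
Unshelve. all: by end_near. Qed.

(** * Passing to nonnegative measures with disjoint supports *)

Lemma meas_restrict (m : nat -> R) (A B : set nat) : fin_meas m ->
  meas (fun x => if x \in B then m x else 0) A = meas m (A `&` B).
Proof.
move=> /fin_measP[s us ms].
rewrite !(@meas_seq _ _ _ _ s us).
- by rewrite -big_mkcondr; apply: eq_bigl => x; rewrite in_setI.
- by move=> x [_ /ms].
- by move=> x [_]; rewrite /supp /=; case: ifP => _; [exact: ms|rewrite eqxx].
Qed.

(* Disjointness of the supports makes the two parts of A where the measures are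
   respectively positive and nonpositive independent of k, so that no Schur-type
   argument is needed to pass to the absolute values. *)
Lemma meas_norm_cvg0 (I : set (set nat)) (m : nat -> nat -> R) :
  (forall X Y, X `<=` Y -> I Y -> I X) ->
  (forall k, fin_meas (m k)) -> trivIset setT (fun k => supp (m k)) ->
  (forall X, I X -> meas (m k) X @[k --> \oo] --> 0) ->
  forall X, I X -> meas (fun x => `|m k x|) X @[k --> \oo] --> 0.
Proof.
move=> Isub fm tm m0 X IX.
pose P := [set x | exists k, 0 < m k x].
have XP : meas (m k) (X `&` P) @[k --> \oo] --> 0.
  by apply: m0; apply: Isub IX => x [].
have XN : meas (m k) (X `\` P) @[k --> \oo] --> 0.
  by apply: m0; apply: Isub IX => x [].
rewrite [X in X @ _](_ : _ = fun k => meas (m k) (X `&` P) - meas (m k) (X `\` P)).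
  by rewrite -[0 in X in _ --> X]subr0; exact: cvgB.
apply/funext => k; rewrite (measID X P); last by rewrite /fin_meas supp_norm; exact: fm.
congr (_ + _).
  apply: eq_fsbigr => x /set_mem[_ [j mjx]].
  have [->|mx] := eqVneq (m k x) 0; first by rewrite normr0.
  have <- : j = k by apply: tm => //; exists x; split; [exact: lt0r_neq0 mjx|exact: mx].
  by rewrite gtr0_norm.
rewrite -measN //; apply: eq_fsbigr => x /set_mem[_ NPx].
rewrite ler0_norm // leNgt; apply/negP => mx; apply: NPx; by exists k.
Qed.

(** Gliding hump: [m (n k)] is chosen nearly null on an initial segment containing the supports of
    all earlier choices, and is cut off there. The pieces have disjoint supports, so
    [meas_norm_cvg0] lets their absolute values replace them. Mass 2k leaves room for the rounding
    in [equal_atoms_below]. *)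
Lemma disjoint_measures (I : set (set nat)) : AN R I ->
  exists (nu : nat -> nat -> R) (N : nat -> nat),
  [/\ forall k x, 0 <= nu k x, forall k, supp (nu k) `<=` `I_(N k),
      forall k, k%:R *+ 2 <= meas (nu k) setT &
      forall X, I X -> meas (nu k) X @[k --> \oo] --> 0].
Proof.
move=> /AN_measures[Isub I1 [m [fm my m0]]].
have /choice[b bP] n : exists b, supp (m n) `<=` `I_b.
  exact: finite_nat_bounded (fm n).
have sumE n N : meas (fun x => `|m n x|) `I_N = \sum_(0 <= x < N) `|m n x|.
  rewrite (@meas_seq _ _ _ _ (index_iota 0 N) (iota_uniq _ _)); last first.
    by move=> x [xN _] /=; rewrite mem_index_iota.
  rewrite big_seq_cond [RHS]big_seq; apply: eq_bigl => x.
  by rewrite mem_index_iota /=; case: (ltnP x N) => //= xN; rewrite mem_set.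
(* Singletons lie in [I], so the variation on a fixed initial segment tends to 0. *)
have sum0 N : meas (fun x => `|m n x|) `I_N @[n --> \oo] --> 0.
  rewrite (_ : (fun n => _) = fun n => \sum_(0 <= x < N) `|m n x|); last first.
    by apply/funext => n; exact: sumE.
  elim: N => [|N IH]; first by under eq_fun do rewrite big_nil; exact: cvg_cst.
  have mN : `|m n N| @[n --> \oo] --> (0 : R).
    apply/norm_cvg0P; have := m0 _ (I1 N).
    by under eq_fun do rewrite /meas fsbig_set1.
  have -> : (fun n => \sum_(0 <= x < N.+1) `|m n x|) =
      (fun n => \sum_(0 <= x < N) `|m n x|) + (fun n => `|m n N|).
    by apply/funext => n; rewrite big_nat_recr.
  by rewrite -[X in _ --> X]addr0; exact: cvgD.
(* An index at least k makes the choices tend to infinity; the bound 1/(k+1) makes the part cut off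
   negligible; and since that part is at most 1, norm 2k + 1 leaves mass 2k. *)
have /choice[g gP] (kN : nat * nat) : exists n, [/\ (kN.1 <= n)%N,
   meas (fun x => `|m n x|) `I_(kN.2) < kN.1.+1%:R^-1 &
   kN.1%:R *+ 2 + 1 <= tvnorm (m n)].
  have c1 : \forall n \near \oo, meas (fun x => `|m n x|) `I_(kN.2) < kN.1.+1%:R^-1.
    have : (0 : R) < kN.1.+1%:R^-1 by rewrite invr_gt0.
    exact: (cvgr_lt _ (sum0 kN.2)).
  have c2 : \forall n \near \oo, kN.1%:R *+ 2 + 1 <= tvnorm (m n).
    exact: cvgry_ge.
  have c3 : \forall n \near \oo, (kN.1 <= n)%N by exact: nbhs_infty_ge.
  have [n [? [? ?]]] := filter_ex (filterI c3 (filterI c1 c2)).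
  by exists n.
(* [N k.+1] bounds the support of [m (n k)], so the k-th piece lives between [N k] and [N k.+1]. *)
pose N := fix N k := if k is k'.+1 then maxn (N k') (b (g (k', N k'))) else 0%N.
pose n k := g (k, N k).
pose m' k x := if x \in ~` `I_(N k) then m (n k) x else 0.
have fm' k : fin_meas (m' k).
  apply: sub_finite_set (fm (n k)) => x; rewrite /supp /= /m'.
  by case: ifP => //; rewrite eqxx.
have supm' k : supp (m' k) `<=` [set x | (N k <= x < N k.+1)%N].
  move=> x; rewrite /supp /= /m'; case: ifPn; last by rewrite eqxx.
  move=> /set_mem /negP; rewrite -leqNgt => -> /bP /=.
  by rewrite leq_max => ->; rewrite orbT.
have Nle : {homo N : i j / (i <= j)%N}.
  by apply: homo_leq => //; [exact: leq_trans|move=> i; rewrite leq_maxl].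
have tm' : trivIset setT (fun k => supp (m' k)).
  move=> i j _ _ [x [/supm'/andP[ix xi] /supm'/andP[jx xj]]].
  apply/eqP; rewrite eqn_leq; apply/andP; split; rewrite leqNgt; apply/negP.
    by move=> /Nle /leq_trans => /(_ _ ix); rewrite leqNgt xj.
  by move=> /Nle /leq_trans => /(_ _ jx); rewrite leqNgt xi.
exists (fun k x => `|m' k x|), (fun k => N k.+1); split => //.
- by move=> k x; rewrite /supp /= normr_eq0 => /supm' /andP[].
- move=> k; have [_ lt1 le2] := gP (k, N k).
  have -> : (fun x => `|m' k x|) =
      fun x => if x \in ~` `I_(N k) then `|m (n k) x| else 0.
    by apply/funext => x; rewrite /m'; case: ifP => _ //; rewrite normr0.
  have fnm : fin_meas (fun x => `|m (n k) x|) by rewrite /fin_meas supp_norm; exact: fm.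
  rewrite meas_restrict // -setDE -(lerD2r 1) (le_trans le2) //.
  rewrite [tvnorm _](measID setT `I_(N k) fnm) setTI addrC lerD2l.
  by rewrite (le_trans (ltW lt1)) // invf_le1 ?ltr0n // ler1n.
apply: meas_norm_cvg0 => // X IX.
have nk : n k @[k --> \oo] --> \oo.
  apply/cvgnyPge => A; near=> k; have [le_kn _ _] := gP (k, N k).
  by apply: leq_trans le_kn; near: k; exact: nbhs_infty_ge.
have mX : meas (m (n k)) X @[k --> \oo] --> 0.
  exact: (cvg_comp _ _ nk (m0 X IX)).
have mX' : meas (m (n k)) (X `&` `I_(N k)) @[k --> \oo] --> 0.
  apply/norm_cvg0P; apply: (squeeze_cvgr _ (cvg_cst 0) (@cvg_harmonic R)).
  near=> k; rewrite normr_ge0 /=; have [_ lt1 _] := gP (k, N k).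
  apply: le_trans (ltW lt1); apply: le_trans (ler_norm_meas _ (fm _)) _.
  by apply: ler_meas => //; rewrite /fin_meas supp_norm; exact: fm.
rewrite [X in X @ _](_ : _ = fun k => meas (m (n k)) X - meas (m (n k)) (X `&` `I_(N k))).
  by rewrite -[0 in X in _ --> X]subr0; exact: cvgB.
by apply/funext => k; rewrite (measID X `I_(N k) (fm _)) addrC addKr meas_restrict // setDE.
Unshelve. all: by end_near. Qed.

(** * Rounding a measure down to equal atoms *)

Lemma count_nth_le (a : pred nat) (s : seq nat) n : (n <= size s)%N ->
  (count (fun i => a (nth 0 s i)) (iota 0 n) <= count a s)%N.
Proof.
move=> ns; rewrite -(count_map (nth 0 s)) map_nth_iota0 //.
by rewrite -[X in (_ <= count a X)%N](cat_take_drop n) count_cat leq_addr.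
Qed.

(* Rounding nu down to multiples of w costs at most w per point, so after paying
   w * N there is still room for M atoms of weight w. *)
Lemma equal_atoms_below (nu : nat -> R) (N M : nat) (w : R) : 0 < w ->
  (forall x, 0 <= nu x) -> w * (N + M)%:R <= \sum_(0 <= x < N) nu x ->
  exists t : nat -> nat, forall a : pred nat,
    w * (count (fun i => a (t i)) (iota 0 M))%:R <= \sum_(0 <= x < N | a x) nu x.
Proof.
move=> w0 nu0 wNM; pose c x := Num.truncn (nu x / w).
have nuw0 x : 0 <= nu x / w by rewrite divr_ge0 // ltW.
(* [s] repeats each x as often as [w] fits into [nu x]; its first [M] entries serve as the atoms. *)
pose s := flatten [seq nseq (c x) x | x <- index_iota 0 N].
have countE a : count a s = (\sum_(0 <= x < N | a x) c x)%N.
  rewrite count_flatten sumnE !big_map [RHS]big_mkcond /=; apply: eq_bigr => x _.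
  by rewrite count_nseq; case: (a x); rewrite ?mul1n.
have Ms : (M <= size s)%N.
  rewrite -(@ler_nat R) -count_predT countE natr_sum -(ler_pM2l w0).
  rewrite natrD mulrDr -lerBrDl in wNM; rewrite (le_trans wNM) //.
  rewrite -[N in w * N%:R]subn0 -sumr_const_nat mulr_sumr mulr_sumr -sumrB.
  apply: ler_sum => x _; rewrite lerBlDr mulr1 -[X in _ <= _ + X]mulr1 -mulrDr.
  by rewrite mulrC -ler_pdivrMr // natr1 ltW //; have /andP[] := truncn_itv (nuw0 x).
exists (nth 0 s) => a.
rewrite (@le_trans _ _ (w * (count a s)%:R)) ?ler_pM2l ?ler_nat ?count_nth_le //.
rewrite countE natr_sum mulr_sumr; apply: ler_sum => x _.
by rewrite mulrC -ler_pdivlMr // truncn_le.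
Qed.

(** * The uniform block measures and their ideals *)

(** The coordinate k in the code keeps blocks disjoint, [h k] lets the ideal remember [h], and the
    extra atom keeps the block nonempty when [h k] is 0. *)
Definition block (h : nat -> nat) (k : nat) : seq nat :=
  [seq pickle (k, h k, i) | i <- iota 0 (h k).+1].

Definition block_meas (h : nat -> nat) (k x : nat) : R :=
  if x \in block h k then k%:R / (h k).+1%:R else 0.

Definition block_ideal (h : nat -> nat) : set (set nat) :=
  [set X | meas (block_meas h k) X @[k --> \oo] --> (0 : R)].

Lemma pickle_inj (T : countType) : injective (@pickle T).
Proof. exact: pcan_inj (@pickleK T). Qed.

Lemma block_inj (h : nat -> nat) k : injective (fun i : nat => pickle (k, h k, i)).
Proof. by move=> i j /pickle_inj[]. Qed.

Lemma uniq_block h k : uniq (block h k).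
Proof. by rewrite map_inj_uniq ?iota_uniq //; exact: block_inj. Qed.

Lemma supp_block_meas h k : supp (block_meas h k) `<=` [set` block h k].
Proof. by move=> x; rewrite /supp /= /block_meas; case: ifP; rewrite ?eqxx. Qed.

Lemma fin_block_meas h k : fin_meas (block_meas h k).
Proof. exact: sub_finite_set (@supp_block_meas h k) (finite_seq _). Qed.

Lemma block_meas_ge0 h k x : 0 <= block_meas h k x.
Proof. by rewrite /block_meas; case: ifP => // _; rewrite divr_ge0. Qed.

Lemma mem_block h k l (i : nat) : pickle (l, i) \in block h k -> l = (k, h k).
Proof. by move=> /mapP[j _ /pickle_inj[-> _]]. Qed.

Lemma pickle_block h k (i : nat) : i \in iota 0 (h k).+1 -> pickle (k, h k, i) \in block h k.
Proof. exact: (map_f (fun j => pickle (k, h k, j))). Qed.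

Lemma trivIset_block h : trivIset setT (fun k => supp (block_meas h k)).
Proof.
move=> i j _ _ [x [/supp_block_meas/mapP[a _ ->] /supp_block_meas/mem_block]].
by case.
Qed.

Lemma meas_block h k X : meas (block_meas h k) X =
  k%:R / (h k).+1%:R *
    (count (fun i => pickle (k, h k, i) \in X) (iota 0 (h k).+1))%:R.
Proof.
rewrite (@meas_seq _ _ _ _ _ (uniq_block h k)); last by move=> x [_ /supp_block_meas].
rewrite -sum1_count natr_sum mulr_sumr big_map big_seq_cond [RHS]big_seq_cond.
by apply: eq_bigr => i /andP[ik _]; rewrite mulr1 /block_meas pickle_block.
Qed.

Lemma meas_block_full h k X : [set` block h k] `<=` X ->
  meas (block_meas h k) X = k%:R.
Proof.
move=> hX; rewrite meas_block.
have -> : count (fun i => pickle (k, h k, i) \in X) (iota 0 (h k).+1) = (h k).+1.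
  rewrite -[RHS](size_iota 0) -count_predT; apply: eq_in_count => i ik.
  by rewrite mem_set //; apply: hX => /=; exact: pickle_block.
by rewrite divfK // pnatr_eq0.
Qed.

(** A point lies in at most one block, so its mass is eventually 0, while the k-th total mass is
    k. *)
Lemma block_ideal_AN h : AN R (block_ideal h).
Proof.
apply: AN_of_measures; first exact: fin_block_meas.
- exact: block_meas_ge0.
- move=> x; apply: (cvg_near_cst).
  have [[k xk]|nx] := pselect (exists k, x \in block h k); last first.
    by near=> k; rewrite /block_meas; case: ifPn => // xk; exfalso; apply: nx; exists k.
  case/mapP: xk => i _ ->; near=> l; rewrite /block_meas; case: ifP => // /mem_block[kl _].
  have : (k < l)%N by near: l; exact: nbhs_infty_gt.
  by rewrite kl ltnn.
- apply: ger_cvgy (@cvgr_idn R); near=> k; by rewrite meas_block_full.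
Unshelve. all: by end_near. Qed.

Lemma block_ideal_density h : density_ideal R (block_ideal h).
Proof.
exists (block_meas h); split => //.
- exact: fin_block_meas.
- exact: block_meas_ge0.
- exact: trivIset_block.
Qed.

(* Each block records the value h k, so the union of the blocks of h at which h
   and h' differ is negligible for h', while it has mass k for h. *)
Lemma block_ideal_eq h h' : block_ideal h = block_ideal h' -> eventually_eq h h'.
Proof.
move=> hh'; pose X := [set x | exists2 k, h k <> h' k & x \in block h k].
have : block_ideal h' X.
  rewrite /block_ideal /= (_ : (fun k => _) = cst 0); first exact: cvg_cst.
  apply/funext => k; rewrite meas_block.
  rewrite (_ : count _ _ = 0%N) ?mulr0 //; apply/eqP; rewrite -leqn0 leqNgt -has_count.
  apply/hasPn => i _; apply/negP => /set_mem[l hl /mem_block[kl hkl]].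
  by apply: hl; rewrite -hkl kl.
rewrite -hh' => /cvgr0_norm_lt/(_ _ ltr01) hX.
near=> k; apply: contrapT => hk.
have : `|meas (block_meas h k) X| < 1 by near: k.
rewrite meas_block_full; last by move=> x /= xk; exists k.
rewrite normr_nat ltNge ler1n => /negP; apply; near: k; exact: nbhs_infty_gt.
Unshelve. all: by end_near. Qed.

(** * Katetov cofinality of the block ideals *)

(** The Katetov map sends the i-th atom of block k to [t k i], the i-th atom found below [nu k]; for
    large k the block measure of a preimage is then at most the [nu k] measure of the set. *)
Lemma block_ideal_above (I : set (set nat)) : AN R I ->
  exists N : nat -> nat, forall h, (\forall k \near \oo, (N k <= h k)%N) ->
    katetov_le I (block_ideal h).
Proof.
move=> /disjoint_measures[nu [N [nu0 suppnu nuT nuI]]]; exists N => h Nh.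
have measnu k A : meas (nu k) A = \sum_(0 <= x < N k | x \in A) nu k x.
  apply: meas_seq; first exact: iota_uniq.
  by move=> x [_ /suppnu] /=; rewrite mem_index_iota.
(* [t] is constrained only where the atom weight is positive and the block is large enough, which
   holds for all large k. *)
have /choice[t tP] k : exists t : nat -> nat, (0 < k)%N -> (N k <= h k)%N ->
    forall A : set nat, k%:R / (h k).+1%:R *
      (count (fun i => t i \in A) (iota 0 (h k).+1))%:R <= meas (nu k) A.
  have [[k0 Nk]|nk] := pselect ((0 < k)%N /\ (N k <= h k)%N); last first.
    by exists id => k0 Nk; case: nk.
  have w0 : (0 : R) < k%:R / (h k).+1%:R by rewrite divr_gt0 ?ltr0n.
  have [|t tP] := @equal_atoms_below (nu k) (N k) (h k).+1 _ w0 (nu0 k).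
    apply: (@le_trans _ _ (meas (nu k) setT)); last first.
      by rewrite measnu; under eq_bigl do rewrite in_setT.
    (* As [N k <= h k], the sum of [N k] and [(h k).+1] is at most twice [(h k).+1], so atoms of
       weight k / (h k + 1) require mass at most 2k. *)
    apply: le_trans (nuT k); rewrite mulrAC ler_pdivrMr ?ltr0n //.
    rewrite -mulrnA -!natrM ler_nat -mulnA leq_mul2l mul2n -addnn leq_add2r.
    by rewrite leqW ?orbT.
  by exists t => _ _ A; rewrite measnu; apply: (tP (mem A)).
(* Only codes of triples (k, h k, i) carry block mass, so the values of [f] elsewhere, such as the
   default 0, do not affect the estimate. *)
pose f x := if (unpickle x : option (nat * nat * nat)) is Some (k, _, i) then t k i else 0%N.
exists f => A IA; rewrite /block_ideal /=.
apply: (squeeze_cvgr _ (cvg_cst 0) (nuI A IA)).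
near=> k; rewrite meas_ge0 //=; last exact: block_meas_ge0.
rewrite meas_block; apply: le_trans (tP k _ _ A); last 2 first.
- near: k; exact: nbhs_infty_gt.
- by near: k.
rewrite le_eqVlt; apply/orP; left; apply/eqP; congr (_ * _%:R).
by apply: eq_count => i; rewrite -[in RHS](_ : f (pickle (k, h k, i)) = t k i) // /f pickleK.
Unshelve. all: by end_near. Qed.

End nikodym_ideals.

Theorem mainTheorem5 (R : realType) :
  exists FF : set (set (set nat)),
    [/\ FF `<=` AN R,
        has_card_d FF,
        (forall J, FF J -> density_ideal R J) &
        (forall I, AN R I -> exists2 J, FF J & katetov_le I J)].
Proof.
have [D domD minD] : exists2 D, dominating D & forall E, dominating E -> D #<= E.
  apply: exists_min_card; exists setT => g; exists g => //.
  by near=> n.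
exists (block_ideal (R := R) @` D); split.
- by move=> _ [h _ <-]; exact: block_ideal_AN.
- by apply: has_card_d_image => //; exact: block_ideal_eq.
- by move=> _ [h _ <-]; exact: block_ideal_density.
- move=> I /block_ideal_above[N NI]; have [h Dh Nh] := domD N.
  by exists (block_ideal (R := R) h); [exists h|exact: NI].
Unshelve. all: by end_near. Qed.
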